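(* Let $m=2h+1\geq 7$ be odd and let $f_2(x)=x^{3\cdot 2^{h+1}+4}+x^{2^{h+1}+2}+x^{2^{h+1}}\in\mathbb{F}_{2^m}[x]$. Let $s^\infty$ be the sequence $s_t=\operatorname{Tr}(f_2(\alpha^t+1))$, $t\ge0$. Then the binary cyclic code $\mathcal{C}_s$ has parameters $[2^m-1,\,2^m-2-3m,\,d(\mathcal{C}_s)]$ with $4\le d(\mathcal{C}_s)\le 8$, and generator polynomial $$g_s(x)=(x-1)\,m_{\alpha^{-3}}(x)\,m_{\alpha^{-(1+2^{h-1})}}(x)\,m_{\alpha^{-(1+2^{h-1}+2^h)}}(x).$$
   Context: Let $m\ge 1$, $v=2^m-1$, $\alpha$ a primitive element of $\mathbb{F}_{2^m}$, and $\operatorname{Tr}(x)=\sum_{i=0}^{m-1}x^{2^i}$ the absolute trace from $\mathbb{F}_{2^m}$ to $\mathbb{F}_2$. For a polynomial $F$ over $\mathbb{F}_{2^m}$ the binary sequence $s^\infty=(s_t)_{t\ge0}$ is defined by $s_t=\operatorname{Tr}(F(\alpha^t+1))$; it is periodic with period dividing $v$. Its minimal polynomial $g_s(x)$ is the polynomial $1+c_1x+\dots+c_Lx^L\in\mathbb{F}_2[x]$ of least degree $L$ such that $s_i+c_1s_{i-1}+\dots+c_Ls_{i-L}=0$ for all $i\ge L$; its degree $L_s$ is the linear span of $s^\infty$. $\mathcal{C}_s$ denotes the binary cyclic code of length $v$ with generator polynomial $g_s(x)$ (so $\dim\mathcal{C}_s=v-L_s$). For an integer $i$, $m_{\alpha^i}(x)$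 is the minimal polynomial of $\alpha^i$ over $\mathbb{F}_2$. $d(\mathcal{C})$ denotes minimum Hamming distance. *)

(* Defs.v *)
From HB Require Import structures.
From mathcomp Require Import all_boot all_order all_algebra all_field.
Set Implicit Arguments. Unset Strict Implicit. Unset Printing Implicit Defensive.
Import GRing.Theory.
Local Open Scope ring_scope.

Section Defs.
Variable F : finFieldType.

Definition trace (m : nat) (x : F) : F := \sum_(i < m) x ^+ (2 ^ i).

(* Embedding of the prime field F_2 into F (only meaningful when char F = 2). *)
Definition F2toF (c : 'F_2) : F := (nat_of_ord c)%:R.

Definition is_minpoly_F2 (beta : F) (p : {poly 'F_2}) : Prop :=
  [/\ p \is monic, root (map_poly F2toF p) beta &
      forall q : {poly 'F_2}, q != 0 -> root (map_poly F2toF q) beta ->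
        (size p <= size q)%N].
End Defs.

Definition annihilates (s : nat -> 'F_2) (c : {poly 'F_2}) : Prop :=
  forall i : nat, ((size c).-1 <= i)%N ->
    \sum_(j < size c) c`_j * s (i - j)%N = 0.

Definition seq_minpoly (s : nat -> 'F_2) (g : {poly 'F_2}) : Prop :=
  [/\ g`_0 = 1, annihilates s g &
      forall c : {poly 'F_2}, c`_0 = 1 -> annihilates s c ->
        (size g <= size c)%N].

Definition cyclic_code (n : nat) (g : {poly 'F_2}) : {set 'rV['F_2]_n} :=
  [set w : 'rV['F_2]_n | g %| rVpoly w].

Definition hweight (n : nat) (w : 'rV['F_2]_n) : nat :=
  #|[set i : 'I_n | w 0 i != 0]|.

(* Main.v *)
Require Import Defs.
From HB Require Import structures.
From mathcomp Require Import all_boot all_order all_algebra all_field.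
From mathcomp Require Import zify ring.
Set Implicit Arguments. Unset Strict Implicit. Unset Printing Implicit Defensive.
Import GRing.Theory.
Local Open Scope ring_scope.

(* In characteristic 2 the powers of [x + 1] expand so that
   [Tr (f2 (x + 1)) = 1 + Tr (x ^ 3) + Tr (x ^ (1 + 2 ^ (h - 1)))
                        + Tr (x ^ (1 + 2 ^ (h - 1) + 2 ^ h))],
   hence [s_t] is the sum of [z ^ t] over [z = 1] and the conjugates of three
   powers of [alpha].  The three exponents are odd and smaller than [2 ^ (h + 1)],
   which forces their cyclotomic cosets modulo [2 ^ (2 h + 1) - 1] to be full and
   disjoint; so the [3 m + 1] values [z] are distinct, and a polynomial annihilates
   [s] exactly when it vanishes at every [z ^ -1].
   Codewords have even weight because [1] is a zero of the code, and weight 2 is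
   impossible because [alpha ^ -3] is a zero and 3 is coprime to [2 ^ m - 1].
   Finally there are more words of weight 4 than remainders modulo [g], so two of
   them differ by a codeword of weight at most 8. *)

(** * Cyclotomic cosets and power sums *)

(** Modulo [2 ^ (2 * h + 1) - 1], doubling is a cyclic shift of [2 * h + 1] bits, so either the
    shift [j - i] or its complement is at most [h]. Such a shift does not wrap, and oddness then
    forces it to be zero. *)
Lemma odd_cyclotomic_cosets (h a b i j : nat) :
  (0 < h)%N -> odd a -> odd b -> (a < 2 ^ h.+1)%N -> (b < 2 ^ h.+1)%N ->
  (i < 2 * h + 1)%N -> (j < 2 * h + 1)%N ->
  (a * 2 ^ i = b * 2 ^ j %[mod 2 ^ (2 * h + 1) - 1])%N -> a = b /\ i = j.
Proof.
move=> h_gt0; set v := (2 ^ (2 * h + 1) - 1)%N.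
wlog le_ij : a b i j / (i <= j)%N.
  move=> IH oa ob la lb li lj e; case: (leqP i j) => [le|/ltnW le].
    exact: (IH a b i j).
  by have [-> ->] := IH b a j i le ob oa lb la lj li (esym e).
have v_gt0 : (0 < v)%N by rewrite subn_gt0 -{1}(expn0 2) ltn_exp2l // addn1.
have vE : (2 ^ (2 * h + 1) = v + 1)%N by rewrite /v subnK // expn_gt0.
(* A shift by at most [h] bits does not wrap around modulo [v]. *)
have small c d k : odd c -> odd d -> (c < 2 ^ h.+1)%N -> (d < 2 ^ h.+1)%N ->
    (k <= h)%N -> (c = d * 2 ^ k %[mod v])%N -> k = 0%N /\ c = d.
  move=> oc od lc ld lk.
  have lt_v e l : (e < 2 ^ h.+1)%N -> (l <= h)%N -> (e * 2 ^ l < v)%N.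
    move=> le ll.
    have le2 : (e <= 2 ^ h.+1 - 1)%N by rewrite leq_subRL ?expn_gt0 // add1n.
    apply: (@leq_ltn_trans ((2 ^ h.+1 - 1) * 2 ^ h)).
      by apply: leq_mul => //; rewrite leq_exp2l.
    have h1 : (2 ^ h.+1 * 2 ^ h = v + 1)%N.
      by rewrite -vE -expnD; congr (2 ^ _)%N; lia.
    rewrite mulnBl mul1n h1.
    have : (2 ^ 1 <= 2 ^ h)%N by rewrite leq_exp2l.
    by lia.
  rewrite !modn_small ?lt_v //; last by rewrite -(muln1 c) -(expn0 2) lt_v.
  case: k lk => [|k] lk; first by rewrite expn0 muln1.
  by move=> e; move: oc; rewrite e expnS oddM oddM /= andbF.
move=> oa ob la lb li lj e.
have wrap x : (x * 2 ^ (2 * h + 1) = x %[mod v])%N.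
  by rewrite vE mulnDr muln1 -modnDml modnMl.
have cong k x y : (x = y %[mod v])%N -> (x * 2 ^ k = y * 2 ^ k %[mod v])%N.
  by move=> xy; rewrite -modnMml xy modnMml.
have e1 : (a = b * 2 ^ (j - i) %[mod v])%N.
  rewrite -[LHS]wrap -[RHS]wrap -!mulnA -!expnD.
  have := cong (2 * h + 1 - i)%N _ _ e; rewrite -!mulnA -!expnD.
  rewrite (_ : i + _ = 2 * h + 1)%N; last by clear -li; lia.
  by rewrite (_ : j + _ = j - i + (2 * h + 1))%N //; clear -le_ij li; lia.
have [le_kh|lt_hk] := leqP (j - i) h.
  by have [k0 ->] := small _ _ _ oa ob la lb le_kh e1; split=> //; clear -le_ij k0; lia.
(* A shift above [h] is read backwards; its complement would be zero, against [j < 2 * h + 1]. *)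
have e2 : (b = a * 2 ^ (2 * h + 1 - (j - i)) %[mod v])%N.
  rewrite -[LHS]wrap; have := cong (2 * h + 1 - (j - i))%N _ _ e1.
  rewrite -mulnA -expnD => ->; congr (_ * 2 ^ _ %% _)%N.
  by clear -le_ij lj; lia.
have le_kh : (2 * h + 1 - (j - i) <= h)%N by clear -lt_hk; lia.
have [k0 _] := small _ _ _ ob oa lb la le_kh e2.
by clear -k0 lj; lia.
Qed.

(* Evaluating a polynomial that vanishes on [Z] except at one point isolates
   the corresponding weight. *)
Lemma weighted_power_sums_eq0 (K : fieldType) (Z : seq K) (b : K -> K) (L : nat) :
  uniq Z -> 0 \notin Z ->
  (forall i, (L <= i)%N -> \sum_(z <- Z) b z * z ^+ i = 0) ->
  {in Z, forall z, b z = 0}.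
Proof.
move=> uniqZ Z0 sum0 z zZ.
(* By linearity the hypothesis extends to all polynomial multiples of ['X^L]. *)
have sum_q (q : {poly K}) : \sum_(y <- Z) b y * y ^+ L * q.[y] = 0.
  under eq_bigr do rewrite horner_coef mulr_sumr.
  rewrite exchange_big big1 // => i _.
  transitivity (q`_i * \sum_(y <- Z) b y * y ^+ (L + i)).
    by rewrite mulr_sumr; apply: eq_bigr => y _; rewrite exprD; ring.
  by rewrite sum0 ?leq_addr // mulr0.
pose q := \prod_(y <- rem z Z) ('X - y%:P).
have := sum_q q; rewrite (perm_big _ (perm_to_rem zZ)) big_cons.
rewrite big_seq big1 /= ?addr0 => [/eqP|y yZ]; last first.
  by rewrite (rootP (_ : root q y)) ?mulr0 // root_prod_XsubC.
have z0 : z != 0 by apply: contraNneq Z0 => <-.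
have qz : q.[z] != 0 by rewrite -[_ == 0]/(root q z) root_prod_XsubC mem_rem_uniqF.
by rewrite !mulf_eq0 (negPf qz) expf_eq0 (negPf z0) andbF !orbF => /eqP.
Qed.

(** * Trace, conjugates and minimal polynomials over ['F_2] *)

Section BinaryField.
Variables (F : finFieldType) (m : nat).
Hypotheses (m_gt0 : (0 < m)%N) (cardF : #|F| = (2 ^ m)%N).

(** Taking [x = -1] in [x ^+ #|F| = x] gives [-1 = 1], since [2 ^ m] is even. *)
Lemma pchar_card2X : 2 \in [pchar F].
Proof.
rewrite inE /=; apply/eqP.
have e : (-1 : F) = 1.
  rewrite -[LHS]expf_card cardF -signr_odd oddX /= orbF.
  by case: m m_gt0.
by rewrite mulr2n -{1}e addNr.
Qed.

Local Notation F2 := (F2toF F).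

Lemma F2toF_is_zmod_morphism : zmod_morphism F2.
Proof.
move=> x y; apply/esym/eqP; rewrite subr_eq; apply/eqP.
rewrite /F2toF -natrD -[RHS](GRing.natr_mod_pchar pchar_card2X).
by congr (_ %:R); move: x y; do 2![case=> [[|[|//]]] ?].
Qed.

Lemma F2toF_is_monoid_morphism : monoid_morphism F2.
Proof.
by split=> // x y; rewrite /F2toF -natrM; congr (_ %:R); move: x y;
  do 2![case=> [[|[|//]]] ?].
Qed.

HB.instance Definition _ :=
  GRing.isZmodMorphism.Build 'F_2 F F2 F2toF_is_zmod_morphism.
HB.instance Definition _ :=
  GRing.isMonoidMorphism.Build 'F_2 F F2 F2toF_is_monoid_morphism.

Lemma expr2XD (k : nat) : {morph (fun x : F => x ^+ (2 ^ k)) : x y / x + y}.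
Proof.
by move=> x y; rewrite exprDn_pchar // pnatX pnatE // pchar_card2X.
Qed.

Lemma traceD : {morph @trace F m : x y / x + y}.
Proof.
move=> x y; rewrite /trace -big_split; apply: eq_bigr => i _; exact: expr2XD.
Qed.

(** Squaring shifts the summands cyclically: the last one becomes [x ^+ (2 ^ m) = x]. *)
Lemma trace_sqr x : trace m (x ^+ 2) = trace m x :> F.
Proof.
rewrite /trace; case: m m_gt0 cardF => // n _ cF.
rewrite big_ord_recr big_ord_recl /= addrC expr1 -exprM -expnS -cF expf_card.
by congr (_ + _); apply: eq_bigr => i _; rewrite -exprM -expnS.
Qed.

Lemma trace_expr2X k x : trace m (x ^+ (2 ^ k)) = trace m x :> F.
Proof. by elim: k x => // k IH x; rewrite expnS exprM IH trace_sqr. Qed.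

Lemma F2_neq0 (c : 'F_2) : c != 0 -> c = 1.
Proof. by case: c => [[|[|//]]] ? // _; apply/val_inj. Qed.

Lemma F2_sqr (c : 'F_2) : c ^+ 2 = c.
Proof. by case: c => [[|[|//]]] ?; apply/val_inj. Qed.

Lemma trace_expr2 x : trace m x ^+ 2 = trace m x :> F.
Proof.
rewrite -[RHS]trace_sqr /trace -(expn1 2).
rewrite (big_morph (fun x : F => x ^+ (2 ^ 1)) (expr2XD 1) (id1 := 0)) ?expr0n //.
by apply: eq_bigr => i _; rewrite -!exprM mulnC.
Qed.

(** The trace satisfies [y ^+ 2 = y], so it is 0 or 1 and the [if] encoding loses nothing. *)
Lemma trace_F2 x : F2 (if trace m x == 0 then 0 else 1) = trace m x.
Proof.
have /eqP := trace_expr2 x; rewrite -subr_eq0 expr2 -{3}[trace m x]mulr1 -mulrBr.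
rewrite mulf_eq0 subr_eq0; case: eqP => [-> _|_ /eqP->]; first exact: rmorph0.
exact: rmorph1.
Qed.

(** Always [m] entries, with repetitions when [x] lies in a proper subfield; distinctness is a
    separate matter. *)
Definition conjugates (x : F) : seq F := [seq x ^+ (2 ^ k) | k <- iota 0 m].

Lemma trace_exprE x t : trace m (x ^+ t) = \sum_(z <- conjugates x) z ^+ t.
Proof.
rewrite /trace /conjugates big_map -(big_mkord xpredT (fun i => (x ^+ t) ^+ (2 ^ i))).
by rewrite /index_iota subn0; apply: eq_bigr => i _; rewrite -!exprM mulnC.
Qed.

Lemma conjugatesV x : [seq z^-1 | z <- conjugates x] = conjugates x^-1.
Proof. by rewrite /conjugates -map_comp; apply: eq_map => k /=; rewrite exprVn. Qed.

(** Frobenius fixes the coefficients, hence sends roots to roots. *)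
Lemma root_F2_conjugates (q : {poly 'F_2}) x :
  root (map_poly F2 q) x -> all (root (map_poly F2 q)) (conjugates x).
Proof.
move=> qx; rewrite all_map; apply/allP => k _ /=.
elim: k => // k; rewrite expnSr exprM; move: (_ ^+ _) => y.
move=> /(rmorph_root (pFrobenius_aut pchar_card2X)).
rewrite -map_poly_comp.
congr (root _ _); apply: eq_map_poly => c /=.
by rewrite pFrobenius_autE -rmorphXn F2_sqr.
Qed.

(* Pigeonhole: there are more polynomials of degree at most [m] than elements. *)
Lemma F2_annihilator (x : F) :
  exists2 q : {poly 'F_2}, q != 0 & (size q <= m.+1)%N /\ root (map_poly F2 q) x.
Proof.
pose ev (u : 'rV['F_2]_m.+1) := (map_poly F2 (rVpoly u)).[x].
have /injectivePn [u [w neq_uw /eqP]] : ~~ injectiveb ev.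
  apply/negP => /injectiveP /leq_card.
  by rewrite card_mx card_Fp // mul1n cardF leq_exp2l // ltnn.
rewrite -subr_eq0 => euw; exists (rVpoly (u - w)).
  apply: contra neq_uw => /eqP e.
  by rewrite -subr_eq0 -[_ - _]rVpolyK e linear0.
split; first exact: size_poly.
by rewrite /root linearB rmorphB hornerD hornerN.
Qed.

(** The [m] distinct conjugates are roots, and an annihilator of degree at most [m] bounds the
    degree of [p], so these are all its roots. *)
Lemma map_minpoly_F2 x (p : {poly 'F_2}) :
  is_minpoly_F2 x p -> uniq (conjugates x) ->
  map_poly F2 p = \prod_(z <- conjugates x) ('X - z%:P).
Proof.
move=> [mon_p px min_p] uniq_x.
have p_neq0 : p != 0 by rewrite monic_neq0.
have roots_p := root_F2_conjugates px.
have size_p : size (map_poly F2 p) = (size (conjugates x)).+1.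
  apply/eqP; rewrite eqn_leq max_poly_roots ?map_poly_eq0 // andbT.
  rewrite size_map_poly size_map size_iota.
  by have [q q0 [sq qx]] := F2_annihilator x; apply: leq_trans sq; apply: min_p.
rewrite (all_roots_prod_XsubC size_p roots_p) ?uniq_rootsE //.
by rewrite lead_coef_map (monicP mon_p) rmorph1 scale1r.
Qed.

(** * Recurrences satisfied by sums of powers *)

(** The recurrence at [i] becomes the sum of [z ^+ i] over [Z] with weights the values of [c] at
    [z^-1]; independence of the powers forces every weight to vanish. *)
Lemma annihilates_root (s : nat -> 'F_2) (Z : seq F) (c : {poly 'F_2}) :
  (forall t, F2 (s t) = \sum_(z <- Z) z ^+ t) -> uniq Z -> 0 \notin Z ->
  annihilates s c <-> all (root (map_poly F2 c)) [seq z^-1 | z <- Z].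
Proof.
move=> sE uniqZ Z0.
have sumE i : ((size c).-1 <= i)%N -> F2 (\sum_(j < size c) c`_j * s (i - j)%N) =
    \sum_(z <- Z) (map_poly F2 c).[z^-1] * z ^+ i.
  move=> ci; rewrite rmorph_sum /=.
  under eq_bigr do rewrite rmorphM /= sE mulr_sumr.
  rewrite exchange_big big_seq [RHS]big_seq; apply: eq_bigr => z zZ.
  have z0 : z != 0 by apply: contraNneq Z0 => <-.
  rewrite horner_coef size_map_poly mulr_suml; apply: eq_bigr => j _.
  rewrite coef_map -mulrA exprB ?unitfE //; last first.
    by apply: leq_trans ci; case: (size c) j => [[]|n j] //=; rewrite -ltnS.
  by rewrite exprVn [_^-1 * _]mulrC.
split=> [ann | /allP roots i ci].
  rewrite all_map; apply/allP => z zZ /=; apply/rootP.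
  apply: (weighted_power_sums_eq0 (b := fun z => (map_poly F2 c).[z^-1])
    (L := (size c).-1) uniqZ Z0) => // i ci.
  by rewrite -sumE // ann ?rmorph0.
apply/eqP; rewrite -(fmorph_eq0 F2) /= sumE // big_seq big1 // => z zZ.
by rewrite (rootP (roots _ (map_f _ zZ))) mul0r.
Qed.

(** [p] divides [g], and minimality of [g] gives the reverse inequality of sizes, so they are
    associate; the only unit of ['F_2] is 1. *)
Lemma seq_minpoly_prod (s : nat -> 'F_2) (Z : seq F) (g p : {poly 'F_2}) :
  (forall t, F2 (s t) = \sum_(z <- Z) z ^+ t) -> uniq Z -> 0 \notin Z ->
  map_poly F2 p = \prod_(z <- [seq z^-1 | z <- Z]) ('X - z%:P) ->
  seq_minpoly s g -> g = p.
Proof.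
move=> sE uniqZ Z0 pE [g0 /(annihilates_root g sE uniqZ Z0) groots gmin].
have uniqV : uniq [seq z^-1 | z <- Z] by rewrite map_inj_uniq //; apply: invr_inj.
(* Minimality of [g] only concerns polynomials with constant term 1; [p] qualifies because none of
   its roots is 0. *)
have p0 : p`_0 = 1.
  apply: F2_neq0; rewrite -(fmorph_eq0 F2) -coef_map -horner_coef0.
  rewrite -[_ == 0]/(root _ 0) pE root_prod_XsubC.
  by apply: contra Z0 => /mapP[z zZ /eqP]; rewrite eq_sym invr_eq0 => /eqP <-.
have p_dvd_g : p %| g by rewrite -(dvdp_map F2) pE uniq_roots_dvdp ?uniq_rootsE.
have g_neq0 : g != 0 by apply: contra_eq_neq g0 => ->; rewrite coef0 eq_sym oner_eq0.
have size_eq : size p = size g.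
  apply/eqP; rewrite eqn_leq dvdp_leq // gmin //.
  by apply/(annihilates_root p sE uniqZ Z0)/allP => z zV; rewrite pE root_prod_XsubC.
have /eqpf_eq [c /F2_neq0 -> ->] : g %= p by rewrite eqp_sym -dvdp_size_eqp ?size_eq.
by rewrite scale1r.
Qed.

(** * The exponents occurring in the sequence *)

(** With [A = x ^+ (2 ^ h.+1)], the argument is [(A + 1)^3 (x^4 + 1) + (A + 1)(x^2 + 1) + (A + 1)].
    Frobenius invariance reduces [A^3], [A x^4] and [A^3 x^4] to the three surviving exponents; the
    other nonconstant traces cancel in pairs. *)
Lemma trace_f2_shift (h : nat) (x : F) : (0 < h)%N -> m = (2 * h + 1)%N ->
  trace m ((x + 1) ^+ (3 * 2 ^ h.+1 + 4) + (x + 1) ^+ (2 ^ h.+1 + 2) +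
           (x + 1) ^+ (2 ^ h.+1)) =
  1 + trace m (x ^+ 3) + trace m (x ^+ (1 + 2 ^ h.-1)) +
  trace m (x ^+ (1 + 2 ^ h.-1 + 2 ^ h)).
Proof.
move=> h_gt0 mE; have two0 : 2 = 0 :> F := pcharf0 pchar_card2X.
have add2 y : y + y = 0 :> F by rewrite -mulr2n -mulr_natr two0 mulr0.
have trace1 : trace m (1 : F) = 1.
  rewrite /trace; under eq_bigr do rewrite expr1n.
  by rewrite sumr_const card_ord mE mulrnDr mulrnA two0 mul0rn add0r.
have tr4 (y : F) : trace m (y ^+ 4) = trace m y := trace_expr2X 2 y.
have e_h : (2 ^ h.+1 = 4 * 2 ^ h.-1)%N by rewrite -{1}(prednK h_gt0) !expnS mulnA.
have e_h1 : (2 ^ h.+1 = 2 * 2 ^ h)%N by rewrite expnS.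
set A := x ^+ (2 ^ h.+1).
have A3 : A ^+ 3 = (x ^+ 3) ^+ (2 ^ h.+1) by rewrite -!exprM mulnC.
have Ax4 : A * x ^+ 4 = (x ^+ (1 + 2 ^ h.-1)) ^+ 4.
  by rewrite -exprD -exprM; congr (x ^+ _); lia.
have A3x4 : A ^+ 3 * x ^+ 4 = (x ^+ (1 + 2 ^ h.-1 + 2 ^ h)) ^+ 4.
  by rewrite -!exprM -exprD; congr (x ^+ _); lia.
have trA : trace m A = trace m x by exact: trace_expr2X.
pose T := A ^+ 3 * x ^+ 4 + A ^+ 3 + (A * x ^+ 2) ^+ 2 + A * x ^+ 4 + A * x ^+ 2 +
  (A ^+ 2 + A + x ^+ 4 + x ^+ 2) + 1.
rewrite [X in trace m X](_ : _ = T); last first.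
  rewrite mulnC !exprD (exprM _ _ 3) !expr2XD -/A expr1n.
  rewrite (expr2XD 2) (expr2XD 1) !expr1n /=.
  (* [ring] does not know that 2 is 0, so the even part of the expansion is supplied by hand as a
     multiple of 0, rewritten as 2. *)
  rewrite -[T](addr0) -(mul0r (A ^+ 2 * x ^+ 4 + A * x ^+ 4 + A ^+ 2 + 2 * A + 1)).
  by rewrite -two0 /T; ring.
rewrite /T A3x4 A3 Ax4 !traceD trace1 !trace_expr2X !trace_sqr !tr4 trA.
set t := trace m x; set u := trace m (A * _).
set r1 := trace m (x ^+ 3); set r2 := trace m _; set r3 := trace m _.
rewrite -[RHS](addr0) -(mul0r (2 * t + u)) -two0; ring.
Qed.

Lemma uniq_conjugates_odd (h : nat) (alpha : F) (E : seq nat) :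
  (0 < h)%N -> m = (2 * h + 1)%N -> (2 ^ m - 1)%N.-primitive_root alpha ->
  uniq E -> all (fun a => odd a && (a < 2 ^ h.+1)%N) E ->
  uniq (1 :: [seq (alpha ^+ a) ^+ (2 ^ k) | a <- E, k <- iota 0 m]).
Proof.
move=> h_gt0 mE prim uniqE /allP oddE; rewrite cons_uniq; apply/andP; split.
  apply/allpairsP => -[[a k] /= [/oddE /andP[oa la]]]; rewrite mem_iota => /= lk.
  (* A conjugate equal to 1 would give [alpha ^+ a = 1], although [0 < a < 2 ^ m - 1]. *)
  move=> /esym /(congr1 (fun z => z ^+ (2 ^ (m - k)))).
  rewrite expr1n -exprM -expnD subnKC 1?ltnW // -cardF expf_card => /eqP.
  rewrite -[1](expr0 alpha) (eq_prim_root_expr prim) mod0n modn_small.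
    by move=> /eqP a0; rewrite a0 in oa.
  apply: leq_trans la _; rewrite leq_subRL ?expn_gt0 // add1n ltn_exp2l //; lia.
apply: allpairs_uniq => //; first exact: iota_uniq.
move=> [a k] [b l] /allpairsP[[a' k'] /= [/oddE/andP[oa la] kI [-> ->]]].
move=> /allpairsP[[b' l'] /= [/oddE/andP[ob lb] lI [-> ->]]] /eqP.
rewrite -!exprM (eq_prim_root_expr prim) mE => /eqP e.
move: kI lI; rewrite !mem_iota mE /= => kI lI.
by have [-> ->] := odd_cyclotomic_cosets h_gt0 oa ob la lb kI lI e.
Qed.

(** * Weights and dimension of cyclic codes *)

(** Nonzero coefficients of a binary word are all 1, so evaluation sums powers over the support. *)
Lemma cyclic_code_root (n : nat) (g : {poly 'F_2}) (w : 'rV['F_2]_n) (x : F) :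
  w \in cyclic_code n g -> root (map_poly F2 g) x ->
  \sum_(i in [set i | w 0 i != 0]) x ^+ i = 0.
Proof.
rewrite inE => gw gx; have /rootP : root (map_poly F2 (rVpoly w)) x.
  by case/dvdpP: gw => q ->; rewrite rmorphM rootM gx orbT.
rewrite (horner_coef_wide (n := n)); last first.
  by rewrite size_map_poly size_poly.
move=> e; rewrite -[RHS]e big_mkcond; apply: eq_bigr => i _.
rewrite coef_map coef_rVpoly_ord inE /=.
case: eqP => [-> | w0]; first by rewrite /F2toF mul0r.
rewrite (F2_neq0 (introN eqP w0)).
by rewrite /F2toF mul1r.
Qed.

Lemma cyclic_code_weight_ge4 (n : nat) (g : {poly 'F_2}) (x : F)
    (w : 'rV['F_2]_n) :
  root (map_poly F2 g) 1 -> root (map_poly F2 g) x ->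
  {in gtn n &, injective (fun i => x ^+ i)} ->
  w \in cyclic_code n g -> w != 0 -> (4 <= hweight w)%N.
Proof.
move=> g1 gx inj_x gw w0; have pcharF := pchar_card2X.
have := cyclic_code_root gw g1.
under eq_bigr do rewrite expr1n.
rewrite sumr_const => /eqP; rewrite -(dvdn_pcharf pcharF) dvdn2 => even_w.
have : (0 < hweight w)%N.
  rewrite lt0n; apply: contraNneq w0 => /eqP; rewrite cards_eq0 => /eqP/setP e.
  by apply/eqP/rowP => i; have := e i; rewrite !inE mxE; case: eqP.
have : hweight w != 2.
  apply/negP => /cards2P[i [j [neq_ij wE]]].
  have := cyclic_code_root gw gx; rewrite wE big_setU1 ?inE // big_set1 => /eqP.
  rewrite addr_eq0 (oppr_pchar2 pcharF) => /eqP /inj_x e.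
  by case/eqP: neq_ij; apply/val_inj/e; rewrite inE ltn_ord.
by move: even_w; rewrite -/(hweight w); move: (hweight w) => [|[|[|[|]]]].
Qed.

Definition F2_embedding : {rmorphism 'F_2 -> F} := F2.
End BinaryField.

(** Multiplication by [g] is a bijection from the polynomials of size at most [n - (size g).-1] onto
    the code. *)
Lemma card_cyclic_code (n : nat) (g : {poly 'F_2}) :
  g != 0 -> ((size g).-1 <= n)%N ->
  #|cyclic_code n g| = (2 ^ (n - (size g).-1))%N.
Proof.
move=> g0 le_gn; set k := (n - _)%N.
have kE : (k + (size g).-1 = n)%N by rewrite subnK.
clearbody k.
pose enc (u : 'rV['F_2]_k) : 'rV['F_2]_n := poly_rV (rVpoly u * g).
have size_enc (u : 'rV['F_2]_k) : (size (rVpoly u * g)%R <= n)%N.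
  apply: leq_trans (size_polyMleq _ _) _.
  have : (size (rVpoly u) <= k)%N := size_poly _ _.
  have : (0 < size g)%N by rewrite size_poly_gt0.
  by move: kE; move: (size g) (size (rVpoly u)) => a b; lia.
have inj_enc : injective enc.
  move=> u w /(congr1 rVpoly); rewrite !poly_rV_K //.
  by move=> /(mulIf g0) /(congr1 (@poly_rV _ k)); rewrite !rVpolyK.
have -> : (2 ^ k = #|[set: 'rV['F_2]_k]|)%N.
  by rewrite cardsT card_mx card_Fp // mul1n.
rewrite -(card_imset _ inj_enc); apply: eq_card => w.
rewrite inE; apply/idP/imsetP => [/dvdpP[q qE] | [u _ ->]]; last first.
  by rewrite poly_rV_K // dvdp_mull.
exists (poly_rV q) => //; have [w0|w0] := eqVneq (rVpoly w) 0.
  move: qE; rewrite w0 => /esym/eqP; rewrite mulf_eq0 (negPf g0) orbF => /eqP ->.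
  by rewrite /enc linear0 linear0 mul0r -w0 rVpolyK.
have q0 : q != 0 by apply: contraNneq w0 => q0; rewrite qE q0 mul0r.
rewrite /enc poly_rV_K -?qE ?rVpolyK //.
have : (size (rVpoly w) <= n)%N := size_poly _ _.
rewrite qE size_mul //; have : (0 < size g)%N by rewrite size_poly_gt0.
by move: kE; move: (size g) (size q) => a b; lia.
Qed.

(* Pigeonhole on the remainders modulo [g] of the words of weight [k]. *)
Lemma cyclic_code_low_weight (n k : nat) (g : {poly 'F_2}) :
  g != 0 -> (2 ^ (size g).-1 < 'C(n, k))%N ->
  exists2 w, w \in cyclic_code n g & w != 0 /\ (hweight w <= k + k)%N.
Proof.
move=> g0 lt_card.
pose chi (A : {set 'I_n}) : 'rV['F_2]_n := \row_i (i \in A)%:R.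
pose syn (A : {set 'I_n}) : 'rV['F_2]_(size g).-1 := poly_rV (rVpoly (chi A) %% g).
have : ~~ dinjectiveb syn [set A : {set 'I_n} | #|A| == k].
  apply/negP => /dinjectiveP /leq_card_in.
  by rewrite card_draws card_ord card_mx card_Fp // mul1n leqNgt lt_card.
move=> /dinjectivePn[A Ak [B /andP[neq_BA Bk]]] synE.
have {}synE : rVpoly (chi A) %% g = rVpoly (chi B) %% g.
  (* Remainders fit into [(size g).-1] coefficients, so [poly_rV] truncates nothing. *)
  have szr p : (size (p %% g)%R <= (size g).-1)%N.
    by rewrite -ltnS prednK ?size_poly_gt0 // ltn_modp.
  by move: synE => /(congr1 rVpoly); rewrite !poly_rV_K.
exists (chi A - chi B); first by rewrite inE linearB /dvdp modpD modpN synE subrr.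
split.
  apply: contra neq_BA; rewrite subr_eq0 => /eqP/rowP e; apply/eqP/setP => i.
  by have := e i; rewrite !mxE; do 2!case: (_ \in _).
move: Ak Bk; rewrite !inE => /eqP {2}<- /eqP <-.
apply: leq_trans (leq_card_setU A B); apply: subset_leq_card.
apply/subsetP => i; rewrite !inE !mxE.
by do 2!case: (_ \in _); rewrite ?subrr ?eqxx.
Qed.

(** After multiplication by [4!], the claim for [N = 2 ^ m] reads
    [48 N^3 < (N - 1)(N - 2)(N - 3)(N - 4)]. *)
Lemma low_weight_count (m : nat) : (7 <= m)%N ->
  (2 ^ (3 * m + 1) < 'C(2 ^ m - 1, 4))%N.
Proof.
move=> m7; have : (2 ^ 7 <= 2 ^ m)%N by rewrite leq_exp2l.
rewrite expnD mulnC -(mulnC m) expnM; set N := (2 ^ m)%N => N128.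
rewrite -(@ltn_pmul2r 4`!) // bin_ffact !ffactnS ffactn0 muln1.
(* In terms of [M] the difference of the two sides has only positive coefficients. *)
have [M ->] : exists M, N = (M + 128)%N by exists (N - 128)%N; lia.
have -> : (M + 128 - 1 = M + 127)%N by lia.
have [-> -> ->] : [/\ (M + 127).-1 = M + 126, (M + 126).-1 = M + 125 &
  (M + 125).-1 = M + 124]%N by split; lia.
have -> : 4`! = 24 by [].
rewrite !expnS expn0.
by lia.
Qed.

(** An odd power of 2 is 2 modulo 3. *)
Lemma coprime3_expn2_odd (h : nat) : coprime 3 (2 ^ (2 * h + 1) - 1).
Proof.
have [q ->] : exists q, (2 ^ (2 * h + 1) = 3 * q + 2)%N.
  elim: h => [|h [q IH]]; first by exists 0%N.
  exists (4 * q + 2)%N.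
  by rewrite (_ : 2 * h.+1 + 1 = (2 * h + 1).+2)%N ?expnS ?IH; lia.
by rewrite prime_coprime // -addnBA // dvdn_addr ?dvdn_mulr.
Qed.

(** * Generator polynomial and parameters of the code *)

Theorem theorem2 (F : finFieldType) (m h : nat) (alpha : F)
  (Hm : m = (2 * h + 1)%N) (Hm7 : (7 <= m)%N)
  (HF : #|F| = (2 ^ m)%N)
  (Halpha : (2 ^ m - 1)%N.-primitive_root alpha)
  (f2 : F -> F)
  (Hf2 : forall x, f2 x = x ^+ (3 * 2 ^ h.+1 + 4) + x ^+ (2 ^ h.+1 + 2) + x ^+ (2 ^ h.+1))
  (s : nat -> 'F_2)
  (Hs : forall t, s t = (if trace m (f2 (alpha ^+ t + 1)) == 0 then 0 else 1))
  (g p1 p2 p3 : {poly 'F_2})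
  (Hg : seq_minpoly s g)
  (Hp1 : is_minpoly_F2 (alpha ^- 3) p1)
  (Hp2 : is_minpoly_F2 (alpha ^- (1 + 2 ^ h.-1)) p2)
  (Hp3 : is_minpoly_F2 (alpha ^- (1 + 2 ^ h.-1 + 2 ^ h)) p3) :
  g = ('X - 1) * p1 * p2 * p3 /\
  #|cyclic_code (2 ^ m - 1) g| = (2 ^ (2 ^ m - 2 - 3 * m))%N /\
  (forall w, w \in cyclic_code (2 ^ m - 1) g -> w != 0 -> (4 <= hweight w)%N) /\
  (exists2 w, w \in cyclic_code (2 ^ m - 1) g & w != 0 /\ (hweight w <= 8)%N).
Proof.
have h_ge3 : (3 <= h)%N by lia.
have m_gt0 : (0 < m)%N by lia.
have h_gt0 : (0 < h)%N by lia.
pose f := F2_embedding m_gt0 HF.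
have alpha0 : alpha != 0.
  apply/eqP => a0; have := prim_expr_order Halpha; rewrite a0 expr0n.
  by rewrite gtn_eqF ?(prim_order_gt0 Halpha) // => /eqP; rewrite eq_sym oner_eq0.
set a2 := (1 + 2 ^ h.-1)%N in Hp2; set a3 := (1 + 2 ^ h.-1 + 2 ^ h)%N in Hp3.
pose E := [:: 3; a2; a3].
(* Expressed through [2 ^ h.-1], which is at least 4, the exponents in [E] are visibly distinct and
   below [2 ^ h.+1]. *)
have [e1 e2 e3] : [/\ 2 ^ h = 2 * 2 ^ h.-1, 2 ^ h.+1 = 4 * 2 ^ h.-1 & 4 <= 2 ^ h.-1]%N.
  split; first by rewrite -expnS prednK.
    by rewrite -{1}(prednK h_gt0) !expnS mulnA.
  by rewrite -[4%N]/(2 ^ 2)%N leq_exp2l // -ltnS prednK.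
have uniqE : uniq E by rewrite /= !inE /a2 /a3 e1; lia.
have oddE : all (fun a => odd a && (a < 2 ^ h.+1)%N) E.
  have odd2X k : (0 < k)%N -> odd (2 ^ k) = false by case: k => // k; rewrite oddX.
  rewrite /= /a2 /a3 !oddD !odd2X //=; last by rewrite -ltnS prednK // ltnW.
  by rewrite e1 e2; lia.
(* The entry 1 accounts for the constant term of the trace expansion and yields the factor
   ['X - 1]. *)
pose Z := 1 :: conjugates m (alpha ^+ 3) ++ conjugates m (alpha ^+ a2) ++
  conjugates m (alpha ^+ a3).
have uniqZ : uniq Z.
  have := uniq_conjugates_odd m_gt0 HF h_gt0 Hm Halpha uniqE oddE.
  by rewrite /allpairs /= cats0.
have [u1 u2 u3] : [/\ uniq (conjugates m (alpha ^+ 3)),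
    uniq (conjugates m (alpha ^+ a2)) & uniq (conjugates m (alpha ^+ a3))].
  by move: uniqZ => /= /andP[_]; rewrite !cat_uniq => /and3P[-> _ /and3P[-> _ ->]].
have conj0 a : 0 \notin conjugates m (alpha ^+ a).
  by apply/mapP => -[k _ /eqP]; rewrite eq_sym -exprM expf_eq0 (negPf alpha0) andbF.
have Z0 : 0 \notin Z.
  by rewrite inE !mem_cat !negb_or eq_sym oner_eq0 !conj0.
have sE t : F2toF F (s t) = \sum_(z <- Z) z ^+ t.
  rewrite Hs (trace_F2 m_gt0 HF) Hf2 (trace_f2_shift m_gt0 HF _ h_gt0 Hm).
  rewrite big_cons !big_cat expr1n -!trace_exprE //= !addrA.
  by rewrite -!exprM !(mulnC t).
have mapV a p : is_minpoly_F2 (alpha ^- a) p -> uniq (conjugates m (alpha ^+ a)) ->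
    map_poly (F2toF F) p =
    \prod_(z <- [seq z^-1 | z <- conjugates m (alpha ^+ a)]) ('X - z%:P).
  move=> pP ua; rewrite conjugatesV; apply: map_minpoly_F2 => //.
  by rewrite -conjugatesV map_inj_uniq //; apply: invr_inj.
have pE : map_poly (F2toF F) (('X - 1) * p1 * p2 * p3) =
    \prod_(z <- [seq z^-1 | z <- Z]) ('X - z%:P).
  rewrite /= big_cons !map_cat !big_cat /= -(mapV _ _ Hp1) // -(mapV _ _ Hp2) //.
  rewrite -(mapV _ _ Hp3) // !(rmorphM (map_poly f)) (rmorphB (map_poly f)).
  rewrite (rmorph1 (map_poly f)) /= (map_polyX f).
  by rewrite invr1 !mulrA.
have gE : g = ('X - 1) * p1 * p2 * p3
  := seq_minpoly_prod m_gt0 HF sE uniqZ Z0 pE Hg.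
have size_g : size g = (3 * m + 2)%N.
  rewrite -(size_map_poly f) /= gE pE size_prod_XsubC size_map /= !size_cat.
  by rewrite !size_map size_iota; lia.
have g0 : g != 0 by rewrite -size_poly_gt0 size_g addn2.
have deg_g : (size g).-1 = (3 * m + 1)%N by rewrite size_g addn2 addn1.
(* The degree of [g] must not exceed the length; induction starts from [22 <= 127] at [m = 7]. *)
have large : (3 * m + 1 <= 2 ^ m - 1)%N.
  have -> : m = (m - 7 + 7)%N by lia.
  rewrite expnD; elim: (m - 7)%N => // k IH; rewrite expnS; lia.
have rootZ z : z \in Z -> root (map_poly (F2toF F) g) z^-1.
  by move=> zZ; rewrite gE pE root_prod_XsubC map_f.
split=> //; split; [|split].
- by rewrite card_cyclic_code // deg_g //; congr (2 ^ _)%N; lia.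
- move=> w; apply: (@cyclic_code_weight_ge4 _ m m_gt0 HF _ _ (alpha ^- 3)).
  + by rewrite -invr1 rootZ ?mem_head.
  + apply: rootZ; rewrite inE mem_cat orbC; apply/orP; left; apply/orP; left.
    by apply/mapP; exists 0%N; rewrite ?mem_iota.
  move=> i j li lj; rewrite !exprVn => /invr_inj/eqP.
  have prim3 : (2 ^ m - 1)%N.-primitive_root (alpha ^+ 3).
    by rewrite (prim_root_exp_coprime _ Halpha) Hm coprime3_expn2_odd.
  by rewrite (eq_prim_root_expr prim3) !modn_small // => /eqP.
- by apply: (@cyclic_code_low_weight _ 4) => //; rewrite deg_g low_weight_count.
Qed.
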